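(* Let $p_1<p_2<p_3$ be primes and $n_1,n_2,n_3$ positive integers. Let $G$ be a finite non-cyclic abelian group of order $p_1^{n_1}p_2^{n_2}p_3^{n_3}$ and let $P_i$ be the Sylow $p_i$-subgroup of $G$ for $i\in\{1,2,3\}$. Suppose that exactly one Sylow subgroup of $G$ is non-cyclic. Then the following hold. (i) If $p_1=2$ and $P_1$ is non-cyclic, then $\kappa(\mathcal{P}(G))=\min\{|P_2P_3|,\kappa(\mathcal{P}(C))\}$, where $C$ is a maximal cyclic subgroup of $G$ of minimum possible order. More precisely, if $|C|=2^{c}p_2^{n_2}p_3^{n_3}$ for some positive integer $c$, then $\kappa(\mathcal{P}(G))=|P_2P_3|$ if $c>1$, and $\kappa(\mathcal{P}(G))=\kappa(\mathcal{P}(C))$ if $c=1$. (ii) If $p_1=2$ and $P_k$ is non-cyclic, where $\{j,k\}=\{2,3\}$, then $P_1P_j$ is the only minimum cut-set of $\mathcal{P}(G)$ and so $\kappa(\mathcal{P}(G))=|P_1P_j|=p_1^{n_1}p_j^{n_j}$. (iii) If $p_1\geq 3$ and $P_k$ is non-cyclic, where $\{i,j,k\}=\{1,2,3\}$, then $P_iP_j$ is the only minimum cut-set of $\mathcal{P}(G)$ and so $\kappa(\mathcal{P}(G))=|P_iP_j|=p_i^{n_i}p_j^{n_j}$.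
   Context: The power graph $\mathcal{P}(G)$ of a group $G$ is the simple graph with vertex set $G$ in which two distinct vertices $x,y$ are adjacent iff $x\in\langle y\rangle$ or $y\in\langle x\rangle$. A cut-set of a simple graph $\Gamma$ with vertex set $V$ is a subset $X\subseteq V$ such that the induced subgraph on $V\setminus X$ is disconnected (i.e. $V\setminus X$ is the disjoint union of two non-empty sets with no edge between them). A minimum cut-set is a cut-set $X$ with $|X|\leq|Y|$ for every cut-set $Y$. The vertex connectivity $\kappa(\Gamma)$ is the minimum number of vertices whose removal leaves a graph that is disconnected or has only one vertex. A maximal cyclic subgroup of $G$ is a cyclic subgroup not properly contained in any cyclic subgroup of $G$; ''of minimum possible order'' means of smallest order among all maximal cyclic subgroups of $G$. *)

(* Defs.v *)
From mathcomp Require Import all_boot all_fingroup all_solvable.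

Set Implicit Arguments.
Unset Strict Implicit.
Unset Printing Implicit Defensive.

(* Vertices form a subset of the ambient type T; the values of [sg_adj] outside
   [sg_vertices] are never used. *)
Record sgraph (T : finType) := SGraph {
  sg_vertices : {set T};
  sg_adj : rel T;
  sg_adj_sym : symmetric sg_adj;
  sg_adj_irrefl : irreflexive sg_adj
}.

Section Connectivity.

Variables (T : finType) (Gamma : sgraph T).
Local Notation V := (sg_vertices Gamma).

Definition disconnected_on (W : {set T}) : bool :=
  [exists A : {set T}, exists B : {set T},
    [&& A != set0, B != set0, [disjoint A & B], A :|: B == W
      & [forall a in A, forall b in B, ~~ sg_adj Gamma a b]]].

Definition cutset (X : {set T}) : bool :=
  (X \subset V) && disconnected_on (V :\: X).

Definition minimum_cutset (X : {set T}) : bool :=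
  cutset X && [forall Y : {set T}, cutset Y ==> (#|X| <= #|Y|)].

(* When V is nonempty, deleting all vertices but one is always allowed, so the
   default value #|V| of the minimum is never reached. *)
Definition vertex_connectivity : nat :=
  \big[minn/#|V|]_(X : {set T} | (X \subset V) &&
      (disconnected_on (V :\: X) || (#|V :\: X| == 1))) #|X|.

End Connectivity.

Section PowerGraph.

Variable gT : finGroupType.

Definition power_adj : rel gT :=
  fun x y => (x != y) && ((x \in <[y]>%g) || (y \in <[x]>%g)).

Lemma power_adj_sym : symmetric power_adj.
Proof. by move=> x y; rewrite /power_adj eq_sym orbC. Qed.

Lemma power_adj_irrefl : irreflexive power_adj.
Proof. by move=> x; rewrite /power_adj eqxx. Qed.

Definition power_graph (G : {group gT}) : sgraph gT :=
  SGraph G power_adj_sym power_adj_irrefl.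

Definition maximal_cyclic (G C : {group gT}) : bool :=
  [max C | (C \subset G) && cyclic C]%g.

Definition min_order_maximal_cyclic (G C : {group gT}) : Prop :=
  maximal_cyclic G C /\
  forall D : {group gT}, maximal_cyclic G D -> #|C| <= #|D|.

End PowerGraph.

Notation kappa := vertex_connectivity.

(* The indices 1, 2, 3, whose underlying naturals in 'I_3 are 0, 1, 2. *)
Definition i1 : 'I_3 := @Ordinal 3 0 isT.
Definition i2 : 'I_3 := @Ordinal 3 1 isT.
Definition i3 : 'I_3 := @Ordinal 3 2 isT.

(* Main.v *)
Require Import Defs.
From mathcomp Require Import all_boot all_fingroup all_solvable.
From mathcomp Require Import zify.

(** Let r be the prime whose Sylow subgroup R is non-cyclic and let Q be the
    product of the two other Sylow subgroups. Since Q is cyclic of order m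
    prime to r, G is R x Q, and <x>Q is cyclic for every x in G; hence every
    maximal cyclic subgroup M contains Q, and #|M| = r^c * m with c > 0.

    Upper bound. Q is a cut-set ([cutset_Hall]): an element outside Q has
    exactly one subgroup of order r among its powers, adjacent elements
    outside Q have the same one, and R, being non-cyclic, has several of them.

    Lower bound. Let A and B be the two sides left by a cut-set X. If X does
    not contain Q, pick s in Q outside X, say on the side A, and b in B: a
    maximal cyclic subgroup M containing b contains s too, so A and B both
    meet M ([cutset_dichotomy]). A generator of M is adjacent to everything
    in M, so all totient #|M| = totient (r^c) * totient m of them are in X.
    This number exceeds m ([ltn_totient_mul]) unless r^c = 2, or r^c = 3 and
    m is even. In the second case #|M| = 3 * 2^a * q^b, and a finer count of
    the elements that X has in M again gives more than m
    ([missed_three_times]). So for r > 2 every cut-set contains Q or is larger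
    than Q, which makes Q the only minimum cut-set.

    For r = 2, let C be a maximal cyclic subgroup of minimum order 2^c * m. If
    c > 1, no M has order 2m, and the same count gives kappa(G) = m <=
    kappa(C). If c = 1, then kappa(C) <= m, because the m neighbours
    of the involution z of C separate z from the non-identity elements of Q
    ([kappa_cyclic_le_Hall]).
    A cut-set of G not containing Q either cuts some M of order 2m, isomorphic
    to C, or has more than m elements, so kappa(C) <= kappa(G). Conversely, a
    cut-set of C with both sides meeting Q contains the generators of C and
    those of Q, which are 2 * totient m > m elements; in the other cut-sets
    one side lies in C outside Q, has no neighbour outside C, and the cut-set
    of C is one of G ([cutset_extends]). *)

Set Implicit Arguments.
Unset Strict Implicit.
Unset Printing Implicit Defensive.

(** * Bounding the vertex connectivity by cut-sets *)

Section Kappa.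

Variables (T : finType) (Gamma : sgraph T).
Local Notation V := (sg_vertices Gamma).

Lemma kappa_le_cutset X : cutset Gamma X -> kappa Gamma <= #|X|.
Proof.
case/andP=> sXV dX; rewrite /kappa.
elim: (index_enum _) (mem_index_enum X) => // Y s IHs.
rewrite inE big_cons => /predU1P[<-|/IHs leX].
  by rewrite sXV dX geq_minl.
by case: ifP => // _; rewrite geq_min leX orbT.
Qed.

(** The other deletions allowed by the vertex connectivity, those that leave
    one vertex, remove #|V| - 1 vertices. *)
Lemma leq_kappa k :
  k < #|V| -> (forall X, cutset Gamma X -> k <= #|X|) -> k <= kappa Gamma.
Proof.
move=> ltkV leX; rewrite /kappa.
elim/big_ind: _ => [|x y lex ley|X /andP[sXV /orP[dX|/eqP oVX]]].
- exact: ltnW.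
- by rewrite leq_min lex ley.
- by apply: leX; rewrite /cutset sXV.
- have := cardsID X V; rewrite oVX (setIidPr sXV); lia.
Qed.

Lemma unique_minimum_cutset (X0 : {set T}) :
    cutset Gamma X0 -> X0 \proper V ->
    (forall X, cutset Gamma X -> X0 \subset X \/ #|X0| < #|X|) ->
  (forall X, minimum_cutset Gamma X <-> X = X0) /\ kappa Gamma = #|X0|.
Proof.
move=> cX0 pX0 dich.
have leX X : cutset Gamma X -> #|X0| <= #|X|.
  by case/dich=> [/subset_leq_card|/ltnW].
split.
- move=> X; split=> [/andP[cX /forallP minX]|->].
  + have := minX X0; rewrite cX0 /= => leXX0.
    case: (dich X cX) => [sX0X|]; last by rewrite ltnNge leXX0.
    by apply/esym/eqP; rewrite eqEcard sX0X.
  + by rewrite /minimum_cutset cX0; apply/forallP=> Y; apply/implyP=> /leX.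
- apply/eqP; rewrite eqn_leq kappa_le_cutset //= leq_kappa //.
  exact: proper_card.
Qed.

End Kappa.

(** * Pairs of sides of a power graph, and the generators they miss *)

Section Split.

Variable gT : finGroupType.
Implicit Types (A B : {set gT}) (G H M : {group gT}).
Local Open Scope group_scope.

(** Disjointness of A and B is built in, since every x belongs to <[x]>; the
    definition thus says that A and B are disjoint with no edge between them. *)
Definition incomparable A B :=
  forall a b, a \in A -> b \in B -> (a \notin <[b]>) && (b \notin <[a]>).

(** The sides are not required to lie in M: a pair of sides that separates a
    group also restricts to its subgroups, and what a cut-set removes from M
    is then [M :\: (A :|: B)]. *)
Definition splits M A B :=
  [/\ M :&: A != set0, M :&: B != set0 & incomparable A B].

Lemma incomparable_sym A B : incomparable A B -> incomparable B A.
Proof. by move=> AB b a Bb Aa; rewrite andbC AB. Qed.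

Lemma splits_sym M A B : splits M A B -> splits M B A.
Proof. by case=> MA MB AB; split=> //; apply: incomparable_sym. Qed.

Lemma splitsI M A B a b :
  incomparable A B -> a \in M -> a \in A -> b \in M -> b \in B -> splits M A B.
Proof.
by move=> AB Ma Aa Mb Bb; split=> //; apply/set0Pn; [exists a|exists b]; apply/setIP.
Qed.

Lemma splitsN M A B :
  incomparable A B -> splits M A B \/ M :&: A = set0 \/ M :&: B = set0.
Proof.
move=> AB; have [->|MA] := eqVneq (M :&: A) set0; first by right; left.
by have [->|MB] := eqVneq (M :&: B) set0; [right; right | left].
Qed.

Lemma cutset_power_graphP G (X : {set gT}) :
  cutset (power_graph G) X <->
  X \subset G /\ exists A B,
    [/\ A != set0, B != set0, incomparable A B & A :|: B = G :\: X].
Proof.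
split=> [/andP[sXG /existsP[A /existsP[B]]]|].
  case/and5P=> A0 B0 dAB /eqP AB /forallP nAB; split=> //; exists A, B.
  split=> // a b Aa Bb.
  have /forallP/(_ b) := implyP (nAB a) Aa.
  rewrite Bb /= /power_adj negb_and negbK negb_or => /orP[/eqP ab|//].
  by rewrite ab (disjointFl dAB Bb) in Aa.
case=> sXG [A [B [A0 B0 AB UAB]]].
rewrite /cutset sXG /=; apply/existsP; exists A; apply/existsP; exists B.
rewrite A0 B0 UAB eqxx /=; apply/andP; split.
  rewrite -setI_eq0; apply/set0Pn=> -[x /setIP[Ax Bx]].
  by have := AB x x Ax Bx; rewrite cycle_id.
apply/forallP=> a; apply/implyP=> Aa; apply/forallP=> b; apply/implyP=> Bb.
by have /andP[ab ba] := AB a b Aa Bb; rewrite /power_adj negb_and negb_or ab ba orbT.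
Qed.

(** A generator of M is adjacent to every other element of M, so it can be on
    neither side. *)
Lemma generator_missed M A B g :
  splits M A B -> generator M g -> g \notin A :|: B.
Proof.
case=> /set0Pn[a /setIP[Ma Aa]] /set0Pn[b /setIP[Mb Bb]] AB /eqP defM.
rewrite defM in Ma Mb; apply/setUP=> -[Ag | Bg].
  by have := AB g b Ag Bb; rewrite Mb andbF.
by have := AB a g Aa Bg; rewrite Ma.
Qed.

Lemma card_generators M :
  cyclic M -> #|[set g | generator M g]| = totient #|M|.
Proof. by case/cyclicP=> x ->; rewrite -totient_gen. Qed.

Lemma totient_add_le_missed M A B (L : {set gT}) :
    cyclic M -> splits M A B -> L \subset M :\: (A :|: B) ->
    (forall g, g \in L -> ~~ generator M g) ->
  totient #|M| + #|L| <= #|M :\: (A :|: B)|.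
Proof.
move=> cM sM sL genL; rewrite -card_generators // -cardsUI.
have -> : [set g | generator M g] :&: L = set0.
  apply/setP=> g; rewrite !inE; case Lg: (g \in L); rewrite ?andbF ?andbT //.
  exact: negPf (genL g Lg).
rewrite cards0 addn0; apply: subset_leq_card; rewrite subUset sL andbT.
apply/subsetP=> g; rewrite inE => gMg; rewrite inE (generator_missed sM gMg) /=.
by rewrite (eqP gMg) cycle_id.
Qed.

Lemma totient_le_missed M A B :
  cyclic M -> splits M A B -> totient #|M| <= #|M :\: (A :|: B)|.
Proof.
move=> cM sM; have := @totient_add_le_missed M A B set0 cM sM (sub0set _).
by rewrite cards0 addn0; apply=> g; rewrite inE.
Qed.

Lemma totient2_le_missed H M A B :
    cyclic M -> H \proper M -> splits M A B -> splits H A B ->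
  totient #|M| + totient #|H| <= #|M :\: (A :|: B)|.
Proof.
move=> cM pHM sM sH; have sHM := proper_sub pHM.
rewrite -(card_generators (cyclicS sHM cM)); apply: totient_add_le_missed => //.
  apply/subsetP=> g; rewrite inE => gHg; rewrite inE (generator_missed sH gHg) /=.
  by rewrite (subsetP sHM) // (eqP gHg) cycle_id.
move=> g; rewrite inE => /eqP Hg; apply/eqP=> Mg.
by rewrite /proper Mg Hg subxx andbF in pHM.
Qed.

End Split.

(** * Subgroups of cyclic groups and their orders *)

Section CyclicSubgroups.

Variable gT : finGroupType.
Implicit Types H K M : {group gT}.
Local Open Scope group_scope.

Lemma cyclic_subgroup_exists M d :
  cyclic M -> d %| #|M| -> exists2 H : {group gT}, H \subset M & #|H| = d.
Proof.
case/cyclicP=> g ->; rewrite -orderE => dvd; exists <[g ^+ (#[g] %/ d)]>%G.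
  by rewrite /= cycleX.
by rewrite /= -orderE orderXdiv ?divnA ?dvdn_div // mulKn.
Qed.

Lemma mem_cyclicE M H x :
  cyclic M -> H \subset M -> x \in M -> (x \in H) = (#[x] %| #|H|).
Proof. by move=> cM sHM Mx; rewrite -cycle_subG (cardSg_cyclic cM) ?cycle_subG. Qed.

Lemma card_cyclicI M H K :
  cyclic M -> H \subset M -> K \subset M -> #|H :&: K| = gcdn #|H| #|K|.
Proof.
move=> cM sHM sKM; apply/eqP; rewrite eqn_dvd dvdn_gcd !cardSg ?subsetIl ?subsetIr //=.
have [|L sLM oL] := @cyclic_subgroup_exists M (gcdn #|H| #|K|) cM.
  by rewrite (dvdn_trans (dvdn_gcdl _ _)) // cardSg.
rewrite -oL cardSg // subsetI -(cardSg_cyclic cM sLM sHM).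
by rewrite -(cardSg_cyclic cM sLM sKM) oL dvdn_gcdl dvdn_gcdr.
Qed.

End CyclicSubgroups.

Lemma dvdn_pfactor_full p c s d :
  prime p -> 0 < d -> d %| p ^ c.+1 * s -> ~~ (d %| p ^ c * s) -> p ^ c.+1 %| d.
Proof.
move=> pP d0 dvd ndvd; rewrite pfactor_dvdn // ltnNge; apply: contra ndvd => le_c.
have [d' cpd' dE] := pfactor_coprime pP d0.
rewrite dE mulnC dvdn_mul ?dvdn_exp2l //.
(* d' is prime to p, so it divides s. *)
rewrite -(@Gauss_dvdr d' (p ^ c.+1)) ?coprimeXr 1?coprime_sym //.
by apply: dvdn_trans dvd; rewrite dE dvdn_mulr.
Qed.

Lemma leq_double_totient_exp2 k : 2 ^ k <= 2 * totient (2 ^ k).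
Proof.
case: k => [|k]; first by [].
by rewrite totient_pfactor //= mul1n expnS.
Qed.

Lemma coprime_2_3_exp q k :
  prime q -> 3 < q -> coprime 3 (q ^ k) /\ coprime 2 (q ^ k).
Proof.
move=> q_pr q_gt3.
by split; apply: coprimeXr; rewrite prime_coprime // dvdn_prime2 //; apply/eqP; lia.
Qed.

(** * Cuts of a cyclic group of order 3 * 2^a * q^b *)

Section ThreeTimes.

Variable gT : finGroupType.
Implicit Types (A B : {set gT}) (M : {group gT}).
Local Open Scope group_scope.

Section Chain.

(* H2 and H3 are the maximal subgroups of index 2 and 3; the elements outside
   both are those of order 3 * 2^a.+1 * q^i, which form a chain under
   divisibility of orders. *)
Variables (M H2 H3 : {group gT}) (a q b : nat).
Hypotheses (cM : cyclic M) (q_pr : prime q) (q_gt3 : 3 < q).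
Hypotheses (sH2 : H2 \subset M) (sH3 : H3 \subset M).
Hypotheses (oM : #|M| = (3 * (2 ^ a.+1 * q ^ b))%N).
Hypotheses (oH2 : #|H2| = (3 * (2 ^ a * q ^ b))%N) (oH3 : #|H3| = (2 ^ a.+1 * q ^ b)%N).

Lemma order_outside_maximal x :
  x \in M :\: (H2 :|: H3) -> exists2 i, i <= b & #[x] = (3 * (2 ^ a.+1 * q ^ i))%N.
Proof.
rewrite !inE negb_or => /andP[/andP[nH2 nH3] Mx].
have dM : #[x] %| 3 * (2 ^ a.+1 * q ^ b) by rewrite -oM order_dvdG.
rewrite (mem_cyclicE cM) // oH2 in nH2; rewrite (mem_cyclicE cM) // oH3 in nH3.
have d3 : 3 %| #[x].
  apply: (@dvdn_pfactor_full 3 0 (2 ^ a.+1 * q ^ b)) => //.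
  by rewrite expn0 mul1n.
have d2 : 2 ^ a.+1 %| #[x].
  by apply: (@dvdn_pfactor_full 2 a (3 * q ^ b)); rewrite // mulnCA.
have d6 : 3 * 2 ^ a.+1 %| #[x].
  by rewrite Gauss_dvd ?d3 //; apply: coprimeXr.
have [k xE] := dvdnP d6; rewrite mulnC in xE.
rewrite xE mulnA dvdn_pmul2l ?muln_gt0 ?expn_gt0 // in dM.
have /(dvdn_pfactor _ _ q_pr)[i leib kE] := dM.
by exists i => //; rewrite xE kE mulnA.
Qed.

Lemma comparable_outside_maximal x y :
  x \in M :\: (H2 :|: H3) -> y \in M :\: (H2 :|: H3) -> #[x] <= #[y] -> x \in <[y]>.
Proof.
move=> Ux Uy; have [/setDP[Mx _] /setDP[My _]] := (Ux, Uy).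
have [i _ ox] := order_outside_maximal Ux; have [j _ oy] := order_outside_maximal Uy.
rewrite (mem_cyclicE cM) ?cycle_subG // -orderE ox oy.
rewrite !mulnA leq_pmul2l ?muln_gt0 ?expn_gt0 // leq_exp2l ?prime_gt1 // => leij.
by rewrite dvdn_mul ?dvdn_exp2l.
Qed.

(** The orders 3f, 2f and f of the intersections of K with H2, H3 and both
    leave 6f - (3f + 2f - f) elements. *)
Lemma card_outside_maximal (K : {group gT}) f j :
    K \subset M -> f = (2 ^ a * q ^ j)%N -> j <= b -> #|K| = (6 * f)%N ->
  #|K :\: (H2 :|: H3)| = f.*2.
Proof.
move=> sKM fE lejb oK; have [c3 c2] := coprime_2_3_exp (b - j) q_pr q_gt3.
have qE : (q ^ b)%N = (q ^ j * q ^ (b - j))%N by rewrite -expnD subnKC.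
have o2 : #|K :&: H2| = (3 * f)%N.
  rewrite (card_cyclicI cM) // oK oH2 qE.
  rewrite (_ : 3 * _ = (3 * f) * q ^ (b - j))%N; last by rewrite fE; lia.
  rewrite (_ : 6 * f = (3 * f) * 2)%N; last by lia.
  by rewrite -muln_gcdr (eqP c2) muln1.
have o3 : #|K :&: H3| = (2 * f)%N.
  rewrite (card_cyclicI cM) // oK oH3 qE expnS.
  rewrite (_ : 2 * _ * _ = (2 * f) * q ^ (b - j))%N; last by rewrite fE; lia.
  rewrite (_ : 6 * f = (2 * f) * 3)%N; last by lia.
  by rewrite -muln_gcdr (eqP c3) muln1.
have o23 : #|K :&: H2 :&: (K :&: H3)| = f.
  rewrite (card_cyclicI cM) ?(subset_trans (subsetIr _ _)) // o2 o3.
  by rewrite -muln_gcdl mul1n.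
have := cardsUI (K :&: H2) (K :&: H3); rewrite -setIUr o23 o2 o3.
by have := cardsID (H2 :|: H3) K; rewrite oK; lia.
Qed.

(** Let y in M and B have the largest order, K = <[y]>, and let U be the union
    of the two maximal subgroups. As the elements of M outside U form a chain,
    those outside K are above y, hence neither in A nor, by the choice of y, in
    B. The elements of K in U are below y, hence not in A, and B avoids U. If
    #|K| = 6f, these two sets have 2^a.+1 * q^b - 2f and 4f elements. *)
Lemma missed_if_avoids_maximal A B :
  splits M A B -> (H2 :|: H3) :&: B = set0 -> 2 ^ a.+1 * q ^ b < #|M :\: (A :|: B)|.
Proof.
case=> _ /set0Pn[b0 MBb0] AB /setP U_B.
case: (@arg_maxnP _ b0 [pred x | x \in M :&: B] (fun x => #[x]) MBb0) => y MBy maxy.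
have BU x : x \in M :&: B -> x \in M :\: (H2 :|: H3).
  case/setIP=> Mx Bx; have := U_B x; rewrite !inE Bx andbT Mx andbT.
  by move->.
have Uy := BU y MBy; have /setIP[My By] := MBy.
have [i leib oy] := order_outside_maximal Uy.
pose K := <[y]>%G; pose f := (2 ^ a * q ^ i)%N; pose U := H2 :|: H3.
have sKM : K \subset M by rewrite cycle_subG.
have oK : #|K| = (6 * f)%N by rewrite -orderE oy expnS /f; lia.
have oKU := card_outside_maximal sKM (erefl f) leib oK.
have oMU : #|M :\: U| = (2 ^ a.+1 * q ^ b)%N.
  rewrite (@card_outside_maximal M (2 ^ a * q ^ b) b) //; last by rewrite oM expnS; lia.
  by rewrite expnS -mul2n mulnA.
have f0 : 0 < f by rewrite muln_gt0 !expn_gt0 (prime_gt0 q_pr).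
have sub : (M :\: U) :\: K :|: K :&: U \subset M :\: (A :|: B).
  apply/subsetP=> x; case/setUP=> [/setDP[Ux nKx]|/setIP[Kx Ux]].
    have Mx : x \in M by case/setDP: Ux.
    rewrite inE Mx andbT; apply/setUP=> -[Ax|Bx]; last first.
      case/negP: nKx; apply: comparable_outside_maximal => //.
      by apply: maxy; apply/setIP.
    have /andP[nxy nyx] := AB x y Ax By.
    have [le_xy|/ltnW le_yx] := leqP #[x] #[y].
      by case/negP: nxy; apply: comparable_outside_maximal.
    by case/negP: nyx; apply: comparable_outside_maximal.
  rewrite inE (subsetP sKM) // andbT; apply/setUP=> -[Ax|Bx].
    by have := AB x y Ax By; rewrite Kx.
  by have := U_B x; rewrite !inE Bx andbT -in_setU Ux.
apply: leq_trans (subset_leq_card sub).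
have disjK : ((M :\: U) :\: K) :&: (K :&: U) = set0.
  by apply/setP=> x; rewrite !inE; case: (x \in K); rewrite ?andbF.
have := cardsUI ((M :\: U) :\: K) (K :&: U); rewrite disjK cards0 addn0 => ->.
have := cardsID U K; have := cardsID K (M :\: U).
have -> : (M :\: U) :&: K = K :\: U.
  apply/setP=> x; rewrite !inE; case Kx: (x \in K); rewrite ?andbF //.
  by rewrite (subsetP sKM) ?andbT.
rewrite oKU oK; lia.
Qed.

End Chain.

(** With t = 2^a and w = q^b this compares the order 2^a.+1 * q^b.+1 with the
    number 2t(q - 1)w of generators of the cyclic group of order
    3 * 2^a.+1 * q^b.+1, increased by at least half as many elements. *)
Lemma ltn_three_halves t T q w :
    0 < t -> 0 < w -> 3 < q -> t <= T ->
  2 * t * (q * w) < 2 * (t * (q.-1 * w)) + T * (q.-1 * w).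
Proof.
case: q => // u t0 w0; rewrite ltnS /= => u2 tT.
have tw0 : 0 < t * w by rewrite muln_gt0 t0.
have le3 : 3 * (t * w) <= t * (u * w) by rewrite (mulnCA t) leq_mul2r u2 orbT.
have leT : t * (u * w) <= T * (u * w) by rewrite leq_mul2r tT orbT.
have -> : (2 * t * (u.+1 * w) = 2 * (t * w) + 2 * (t * (u * w)))%N.
  by rewrite mulSn mulnDr !mulnA.
clear -tw0 le3 leT; lia.
Qed.

(** The generators alone amount to 1 - 1/q times the order 2^a * q^b. If one of the maximal
    subgroups of index 2 and 3 is split, its generators make up for the
    difference; if the two lie on opposite sides, the elements of their
    intersection do. Otherwise one side avoids both of them. *)
Lemma missed_three_times M A B a q b :
    cyclic M -> prime q -> 3 < q -> 0 < a -> 0 < b ->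
    #|M| = (3 * (2 ^ a * q ^ b))%N -> splits M A B ->
  2 ^ a * q ^ b < #|M :\: (A :|: B)|.
Proof.
case: a b => // a [//|b] cM q_pr q_gt3 _ _ oM sM.
have [_ _ AB] := sM.
have [|H3 sH3 oH3] := @cyclic_subgroup_exists _ M (2 ^ a.+1 * q ^ b.+1) cM.
  by rewrite oM dvdn_mull.
have [|H2 sH2 oH2] := @cyclic_subgroup_exists _ M (3 * (2 ^ a * q ^ b.+1)) cM.
  by rewrite oM !dvdn_mul ?dvdn_exp2l.
have [c3 c2] := coprime_2_3_exp b.+1 q_pr q_gt3.
have m0 : 0 < 2 ^ a * q ^ b by rewrite muln_gt0 !expn_gt0 (prime_gt0 q_pr).
have tot k : totient (3 * (2 ^ k * q ^ b.+1)) = (2 * (totient (2 ^ k) * (q.-1 * q ^ b)))%N.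
  rewrite totient_coprime ?coprimeMr ?c3 ?coprimeXr //.
  by rewrite totient_coprime ?coprimeXl // (totient_pfactor q_pr).
have oMtot : totient #|M| = (2 * (2 ^ a * (q.-1 * q ^ b)))%N.
  by rewrite oM tot totient_pfactor //= mul1n.
have pH (H : {group gT}) : H \subset M -> #|H| < #|M| -> H \proper M.
  by move=> sHM ltHM; rewrite properEcard sHM.
have ltH3 : #|H3| < #|M| by rewrite oH3 oM expnS; nia.
have ltH2 : #|H2| < #|M| by rewrite oH2 oM !expnS; nia.
have t0 : 0 < 2 ^ a by rewrite expn_gt0.
have w0 : 0 < q ^ b by rewrite expn_gt0 (prime_gt0 q_pr).
have := splitsN H3 AB; have := splitsN H2 AB.
case=> [spH2 _|].
  have := totient2_le_missed cM (pH _ sH2 ltH2) sM spH2.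
  rewrite oH2 tot oMtot; apply: leq_trans; rewrite !expnS [X in (_ < _ + X)%N]mulnA.
  exact: ltn_three_halves (leq_double_totient_exp2 a).
move=> avoid2 [spH3|avoid3].
  have := totient2_le_missed cM (pH _ sH3 ltH3) sM spH3.
  rewrite oH3 totient_coprime ?coprimeXl // totient_pfactor //= mul1n.
  rewrite (totient_pfactor q_pr) //= oMtot; apply: leq_trans; rewrite !expnS.
  exact: ltn_three_halves.
(* One maximal subgroup avoids X, the other one Y: their intersection avoids both. *)
have mixed X Y : X :|: Y = A :|: B ->
    H2 :&: X = set0 -> H3 :&: Y = set0 -> 2 ^ a.+1 * q ^ b.+1 < #|M :\: (A :|: B)|.
  move=> XY H2X H3Y.
  have oI : #|H2 :&: H3| = (2 ^ a * q ^ b.+1)%N.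
    rewrite (card_cyclicI cM) // oH2 oH3 (expnS 2 a) -mulnA.
    by rewrite -muln_gcdl mul1n.
  have sI : H2 :&: H3 \subset M :\: (A :|: B).
    apply/subsetP=> x /setIP[H2x H3x]; rewrite inE (subsetP sH2) // andbT -XY.
    apply/setUP=> -[Xx|Yx].
      by have : x \in H2 :&: X by [apply/setIP]; rewrite H2X inE.
    by have : x \in H3 :&: Y by [apply/setIP]; rewrite H3Y inE.
  have := totient_add_le_missed cM sM sI.
  have genI g : g \in H2 :&: H3 -> ~~ generator M g.
    case/setIP=> H2g _; apply/eqP=> gM; rewrite -cycle_subG -gM in H2g.
    by have := subset_leq_card H2g; rewrite leqNgt ltH2.
  move/(_ genI); rewrite oI oMtot; apply: leq_trans; rewrite !expnS.
  apply: leq_trans (ltn_three_halves t0 w0 q_gt3 (leqnn _)) _.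
  by rewrite leq_add2l leq_mul2l leq_mul2r leq_pred !orbT.
case: avoid2 => [H2A|H2B]; case: avoid3 => [H3A|H3B].
- rewrite setUC; apply: (missed_if_avoids_maximal cM q_pr q_gt3 sH2 sH3 oM oH2 oH3).
    exact: splits_sym.
  by rewrite setIUl H2A H3A setU0.
- exact: (mixed A B).
- by apply: (mixed B A); rewrite // setUC.
- apply: (missed_if_avoids_maximal cM q_pr q_gt3 sH2 sH3 oM oH2 oH3) => //.
  by rewrite setIUl H2B H3B setU0.
Qed.

End ThreeTimes.

(** * Cuts of a cyclic group of order r^c * q1^a * q2^b *)

Lemma coprime_pexp p q i j :
  prime p -> prime q -> p != q -> coprime (p ^ i) (q ^ j).
Proof.
by move=> p_pr q_pr pq; rewrite coprimeXl // coprimeXr // prime_coprime // dvdn_prime2.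
Qed.

(** After division by q1^(a-1) * q2^(b-1) this is
    q1 * q2 < totient (r^c) * (q1 - 1) * (q2 - 1). If q1 > 2, then q1 >= 3 and
    q2 >= 5, and totient (r^c) >= 2 is enough. If q1 = 2, then q2 >= 3, and
    totient (r^c) >= 4 is enough; this holds since r >= 5 or 9 divides r^c. *)
Lemma ltn_totient_mul r c q1 a q2 b :
    prime r -> prime q1 -> prime q2 -> r != q1 -> r != q2 -> q1 < q2 ->
    0 < a -> 0 < b -> 2 < r ^ c -> (r ^ c == 3) && (q1 == 2) = false ->
  q1 ^ a * q2 ^ b < totient (r ^ c * (q1 ^ a * q2 ^ b)).
Proof.
move=> r_pr p1 p2 rq1 rq2 lt12 a0 b0 rc2 exc.
rewrite !totient_coprime ?coprimeMr ?coprime_pexp ?(ltn_eqF lt12) //.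
rewrite (totient_pfactor p1) // (totient_pfactor p2) //.
case: a b a0 b0 => // a [//|b] _ _ /=.
have w0 : 0 < q1 ^ a * q2 ^ b by rewrite muln_gt0 !expn_gt0 !prime_gt0.
suff lt : q1 * q2 < totient (r ^ c) * (q1.-1 * q2.-1).
  by rewrite (mulnACA q1.-1) mulnA !expnS (mulnACA q1 (q1 ^ a)) ltn_mul2r w0.
have odd_gt q : prime q -> 2 < q -> q != 4.
  by move=> q_pr _; apply: contraTneq q_pr => ->.
have tot_gt3 : 2 < q1 \/ 3 < totient (r ^ c).
  case: c rc2 exc => [|c] rc2 exc //.
  rewrite totient_pfactor //=.
  have [q1_gt2|q1_le2] := ltnP 2 q1; [by left | right].
  have q1E : q1 = 2 by apply/eqP; rewrite eqn_leq q1_le2 prime_gt1.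
  rewrite q1E eqxx andbT in exc.
  have r2 : 2 < r by rewrite ltn_neqAle prime_gt1 // eq_sym -q1E rq1.
  have r4 := odd_gt r r_pr r2.
  have rc0 : 0 < r ^ c by rewrite expn_gt0 prime_gt0.
  have [r3|r3] := eqVneq r 3; last first.
    have r5 : 4 < r by lia.
    by rewrite (@leq_trans (r.-1 * 1)) // ?leq_mul2l ?rc0 ?orbT //; lia.
  case: c exc {rc2 rc0} => [|c]; first by rewrite r3.
  have : 0 < 3 ^ c by rewrite expn_gt0.
  rewrite r3 expnS; lia.
have tot_gt1 : 1 < totient (r ^ c) by rewrite totient_gt1.
have q1_gt1 := prime_gt1 p1.
case: tot_gt3 => [q1_gt2|tot_gt3].
  have q24 := odd_gt q2 p2 (ltn_trans q1_gt2 lt12).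
  have q2_gt4 : 4 < q2 by lia.
  apply: leq_trans (_ : 2 * (q1.-1 * q2.-1) <= _); last by rewrite leq_mul2r tot_gt1 orbT.
  clear -q1_gt2 q2_gt4; case: q1 q2 q1_gt2 q2_gt4 => // u [//|v] /=; nia.
apply: leq_trans (_ : 4 * (q1.-1 * q2.-1) <= _); last by rewrite leq_mul2r tot_gt3 orbT.
clear -q1_gt1 lt12; case: q1 q2 q1_gt1 lt12 => // u [//|v] /=; nia.
Qed.

Lemma ltn_missed (gT : finGroupType) (M : {group gT}) (A B : {set gT})
    r c q1 a q2 b :
    cyclic M -> splits M A B ->
    prime r -> prime q1 -> prime q2 -> r != q1 -> r != q2 -> q1 != q2 ->
    0 < a -> 0 < b -> 0 < c -> 2 < r ^ c -> #|M| = r ^ c * (q1 ^ a * q2 ^ b) ->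
  q1 ^ a * q2 ^ b < #|M :\: (A :|: B)|.
Proof.
move=> cM sM r_pr p1 p2 rq1 rq2 ne12 a0 b0 c0 rc2 oM.
wlog lt12 : q1 a q2 b p1 p2 rq1 rq2 ne12 a0 b0 oM / q1 < q2.
  move=> IH; have [lt12|lt21|eq12] := ltngtP q1 q2; first exact: IH.
    have ne21 : q2 != q1 by rewrite eq_sym.
    by rewrite mulnC; apply: (IH q2 b q1 a) => //; rewrite oM (mulnC (q1 ^ a)).
  by rewrite eq12 eqxx in ne12.
case exc: ((r ^ c == 3) && (q1 == 2)); last first.
  by apply: leq_trans (totient_le_missed cM sM); rewrite oM ltn_totient_mul.
case/andP: exc => /eqP rc3 /eqP q12.
have r3 : r = 3.
  by apply/eqP; rewrite -(dvdn_prime2 r_pr (isT : prime 3)) -rc3 dvdn_exp.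
rewrite q12; apply: (missed_three_times cM); rewrite ?oM ?rc3 ?q12 //.
by rewrite ltn_neqAle -{1}r3 rq2; lia.
Qed.

(** An isomorphism from M to C carries the sides of a cut of M to C. *)
Lemma kappa_cyclic_le_missed (gT : finGroupType) (M C : {group gT}) (A B : {set gT}) :
    cyclic M -> cyclic C -> #|M| = #|C| -> splits M A B ->
  kappa (power_graph C) <= #|M :\: (A :|: B)|.
Proof.
move=> cM cC oMC [MA MB AB].
have /isogP[f injf fM] : M \isog C by rewrite isog_cyclic_card // cC oMC eqxx.
have inj x y : x \in M -> y \in M -> f x \in <[f y]>%g -> x \in <[y]>%g.
  move=> Mx My; rewrite -morphim_cycle // => /morphimP[z Mz yz fxz].
  by rewrite (injmP injf x z Mx Mz fxz).
have sSC S : (f @* S)%g \subset C by rewrite -fM morphim_sub.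
have <- : #|C :\: (f @* (A :|: B))%g| = #|M :\: (A :|: B)|.
  rewrite !cardsD (setIidPr (sSC _)) -(morphimIdom f (A :|: B)) oMC.
  by rewrite (card_injm injf) // subsetIl.
have ne0 S : M :&: S != set0 -> (f @* S)%g != set0.
  by rewrite -(morphimIdom f S) morphim_eq0 // subsetIl.
apply: kappa_le_cutset; apply/cutset_power_graphP; split; first exact: subsetDl.
exists (f @* A)%g, (f @* B)%g; split; [exact: ne0 | exact: ne0 | |].
- move=> _ _ /morphimP[a Ma Aa ->] /morphimP[b Mb Bb ->].
  have /andP[ab ba] := AB a b Aa Bb.
  by rewrite (contra (inj _ _ Ma Mb) ab) (contra (inj _ _ Mb Ma) ba).
- by rewrite -morphimU setDDr setDv set0U (setIidPr (sSC _)).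
Qed.

(** * Abelian groups with a cyclic Hall r'-subgroup and a non-cyclic Sylow r-subgroup *)

Section OneNoncyclicSylow.

Variables (gT : finGroupType) (G R Q : {group gT}) (r : nat).
Hypotheses (abG : abelian G) (r_pr : prime r).
Hypotheses (sylR : (r.-Sylow(G) R)%g) (ncycR : ~~ cyclic R).
Hypotheses (hallQ : (r^'.-Hall(G) Q)%g) (cycQ : cyclic Q).
Implicit Types (M C : {group gT}) (A B X Y : {set gT}).
Local Open Scope group_scope.

Let sQG : Q \subset G := pHall_sub hallQ.

Lemma mem_cyclic_Hall x : x \in G -> (x \in Q) = r^'.-elt x.
Proof. by move=> Gx; rewrite (mem_normal_Hall hallQ) // -sub_abelian_normal. Qed.

(** The r'-part of x is already in Q, so only its r-part is added, and the
    orders are coprime. *)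
Lemma cyclic_join_Hall x : x \in G -> cyclic (<[x]> <*> Q).
Proof.
move=> Gx; have sxG : <[x]> \subset G by rewrite cycle_subG.
have Gxr pi : x.`_pi \in G by rewrite (subsetP sxG) ?groupX ?cycle_id.
have Qx : x.`_r^' \in Q by rewrite mem_cyclic_Hall ?p_elt_constt.
apply: (@cyclicS _ (<[x.`_r]> <*> Q) (<[x]> <*> Q)).
  rewrite join_subG joing_subr andbT cycle_subG -{1}(consttC r x) groupM //.
    by rewrite mem_gen // inE cycle_id.
  by rewrite mem_gen // inE Qx orbT.
apply: cyclicY; rewrite ?cycle_cyclic //.
  by rewrite (sub_abelian_cent2 abG) // cycle_subG.
exact: pnat_coprime (p_elt_constt r x) (pHall_pgroup hallQ).
Qed.

Lemma maximal_cyclic_sub M : maximal_cyclic G M -> M \subset G /\ cyclic M.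
Proof. by case/maxgroupP=> /andP[]. Qed.

Lemma join_Hall_sub_maximal_cyclic M x :
  maximal_cyclic G M -> x \in G -> M \subset <[x]> <*> Q -> <[x]> <*> Q = M.
Proof.
case/maxgroupP=> _ maxM Gx sMxQ.
apply: (maxM (<[x]> <*> Q)%G) => //=.
by rewrite cyclic_join_Hall // join_subG cycle_subG Gx sQG.
Qed.

Lemma Hall_sub_maximal_cyclic M : maximal_cyclic G M -> Q \subset M.
Proof.
move=> maxM; have [sMG /cyclicP[x Mx]] := maximal_cyclic_sub maxM.
have Gx : x \in G by rewrite -cycle_subG -Mx.
rewrite -(join_Hall_sub_maximal_cyclic maxM Gx); first exact: joing_subr.
by rewrite Mx joing_subl.
Qed.

Lemma exists_maximal_cyclic x :
  x \in G -> exists2 M, maximal_cyclic G M & x \in M.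
Proof.
move=> Gx; pose gP := [pred C : {group gT} | (C \subset G) && cyclic C].
have [|M maxM sxM] := @maxgroup_exists _ gP <[x]>%G.
  by rewrite /= cycle_subG Gx cycle_cyclic.
by exists M; rewrite // -cycle_subG.
Qed.

Lemma exists_rank2_subgroup : exists2 E : {group gT}, E \subset G & E \in 'E_r^2(R).
Proof.
have /p_rank_geP[E EE] : 1 < 'r_r(R).
  rewrite ltnNge; apply: contra ncycR => le1.
  rewrite (abelian_rank1_cyclic (abelianS (pHall_sub sylR) abG)).
  by rewrite (rank_pgroup (pHall_pgroup sylR)).
exists E => //; have /pnElemP[sER _ _] := EE.
exact: subset_trans sER (pHall_sub sylR).
Qed.

(** A cyclic group cannot contain the elementary abelian group of order r^2
    that the non-cyclic abelian group R contains. *)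
Lemma exists_order_r (K : {set gT}) :
  cyclic K -> exists x, [/\ x \in G, #[x] = r & x \notin K].
Proof.
move=> cK; have [E sEG EE] := exists_rank2_subgroup.
have /pnElemP[_ abE oE] := EE.
have ncE : ~~ (E \subset K).
  apply/negP=> sEK; have := abelem_cyclic abE.
  by case/cyclicP: cK sEK => k -> /cyclicS ->; rewrite ?cycle_cyclic // oE.
have [x Ex nKx] := subsetPn ncE.
exists x; split=> //; first exact: (subsetP sEG).
have [_ /(_ x Ex)] := abelemP r_pr abE.
move=> xr; apply: nt_prime_order => //.
by apply: contraNneq nKx => ->; case/cyclicP: cK => k ->; rewrite group1.
Qed.

(** The exponent c is positive: otherwise M = Q, and adjoining an element of
    order r to Q gives a larger cyclic group. *)
Lemma card_maximal_cyclic M :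
  maximal_cyclic G M -> exists2 c, 0 < c & #|M| = (r ^ c * #|Q|)%N.
Proof.
move=> maxM; have [sMG cM] := maximal_cyclic_sub maxM.
have sQM := Hall_sub_maximal_cyclic maxM.
have hallQM := pHall_subl sQM sMG hallQ.
exists (logn r #|M|); last first.
  by rewrite (card_Hall hallQM) -p_part partnC.
rewrite lt0n; apply/eqP=> log0.
have QM : M = Q :> {set gT}.
  apply/esym/eqP; rewrite eqEcard sQM (card_Hall hallQM).
  by rewrite -{1}(partnC r (cardG_gt0 M)) p_part log0 expn0 mul1n leqnn.
have [x [Gx ox nMx]] := exists_order_r cM.
case/negP: nMx; rewrite -(join_Hall_sub_maximal_cyclic maxM Gx).
  by rewrite mem_gen // inE cycle_id.
by rewrite QM joing_subr.
Qed.

Lemma order_r_sub_cycle x :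
  x \in G :\: Q -> exists2 u, u \in <[x]> & #[u] = r.
Proof.
case/setDP=> Gx nQx.
have rx : r %| #|<[x]>|.
  rewrite -orderE; apply: contraR nQx => nrx.
  by rewrite mem_cyclic_Hall // /p_elt p'natE.
by have [u ux ou] := Cauchy r_pr rx; exists u.
Qed.

(** For a fixed u of order r, one side consists of the elements outside Q with
    u among their powers, the other of the remaining elements outside Q. *)
Lemma cutset_Hall : cutset (power_graph G) Q.
Proof.
apply/cutset_power_graphP; split=> //.
have Q1 : cyclic [1 gT] by apply: cyclic1.
have [u [Gu ou _]] := exists_order_r Q1.
have [v [Gv ov nuv]] := exists_order_r (cycle_cyclic u).
have orderQ x : #[x] = r -> x \notin Q.
  move=> ox; apply/negP=> Qx.
  have := mem_p_elt (pHall_pgroup hallQ) Qx.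
  by rewrite /p_elt ox p'natE // dvdnn.
exists ((G :\: Q) :&: [set x | u \in <[x]>]), ((G :\: Q) :\: [set x | u \in <[x]>]).
have sub_prime (x y : gT) : #[x] = r -> #[y] = r -> x \in <[y]> -> <[x]> = <[y]>.
  move=> ox oy xy; apply/eqP; rewrite eqEcard cycle_subG xy.
  by rewrite -!orderE ox oy leqnn.
split; last by rewrite setID.
- by apply/set0Pn; exists u; rewrite !inE orderQ ?Gu ?cycle_id.
- apply/set0Pn; exists v; rewrite !inE orderQ ?Gv ?andbT //.
  by apply/negP=> /(sub_prime _ _ ou ov) uv; rewrite uv cycle_id in nuv.
move=> x y /setIP[_]; rewrite inE => ux /setDP[Uy]; rewrite inE => nuy.
apply/andP; split; apply: contra nuy.
  by rewrite -cycle_subG => /subsetP; apply.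
(* w is a power of y of order r; in the cyclic group <[x]> it generates the same
   subgroup as u. *)
rewrite -cycle_subG => syx; have [w wy ow] := order_r_sub_cycle Uy.
have : <[u]> == <[w]> :> {set gT}.
  rewrite (@eq_subG_cyclic _ <[x]>%G <[u]>%G <[w]>%G) ?cycle_cyclic //=.
  - by rewrite -!orderE ou ow.
  - by rewrite cycle_subG.
  - by rewrite cycle_subG (subsetP syx).
by move=> /eqP uw; rewrite -cycle_subG uw cycle_subG.
Qed.

(** An element of Q outside X lies on one side. Any maximal cyclic subgroup
    containing an element of the other side contains Q, and meets both sides. *)
Lemma cutset_dichotomy X :
    cutset (power_graph G) X ->
  Q \subset X \/
  exists (M : {group gT}) (A B : {set gT}),
    [/\ maximal_cyclic G M, splits M A B & M :\: (A :|: B) = M :&: X].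
Proof.
case/cutset_power_graphP=> sXG [A [B [A0 B0 AB UAB]]].
have [sQX|/subsetPn[s Qs nXs]] := boolP (Q \subset X); [by left | right].
have Gs := subsetP sQG s Qs.
have missed (M : {group gT}) : M \subset G -> M :\: (A :|: B) = M :&: X.
  move=> sMG; rewrite UAB; apply/setP=> x; rewrite !inE.
  by case Mx: (x \in M); rewrite ?andbF //= (subsetP sMG) // !andbT negbK.
have witness (x y : gT) (A' B' : {set gT}) : x \in A' -> A' \subset A :|: B -> x \in G ->
    y \in B' -> y \in Q -> incomparable A' B' ->
    exists2 M, maximal_cyclic G M & splits M A' B'.
  move=> A'x sA' Gx B'y Qy AB'.
  have [M maxM Mx] := exists_maximal_cyclic Gx.
  exists M => //; apply: (splitsI AB' Mx A'x _ B'y).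
  exact: (subsetP (Hall_sub_maximal_cyclic maxM)).
have inG x : x \in A :|: B -> x \in G by rewrite UAB => /setDP[].
have : s \in A :|: B by rewrite UAB inE nXs.
case/setUP=> [As|Bs].
  have /set0Pn[b Bb] := B0.
  have [||||||M maxM sM] := @witness b s B A => //.
  - exact: subsetUr.
  - by apply: inG; rewrite inE Bb orbT.
  - exact: incomparable_sym.
  exists M, A, B; split=> //; first exact: splits_sym.
  by apply: missed; case: (maximal_cyclic_sub maxM).
have /set0Pn[a Aa] := A0.
have [||||||M maxM sM] := @witness a s A B => //.
- exact: subsetUl.
- by apply: inG; rewrite inE Aa.
exists M, A, B; split=> //.
by apply: missed; case: (maximal_cyclic_sub maxM).
Qed.

Lemma proper_Hall : Q \proper G.
Proof.
have [x [Gx _ nQx]] := exists_order_r cycQ.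
by rewrite properE sQG; apply/subsetPn; exists x.
Qed.

Lemma unique_minimum_cutset_Hall q1 a q2 b :
    prime q1 -> prime q2 -> r != q1 -> r != q2 -> q1 != q2 -> 0 < a -> 0 < b ->
    #|Q| = (q1 ^ a * q2 ^ b)%N -> 2 < r ->
  (forall X, minimum_cutset (power_graph G) X <-> X = Q)
  /\ kappa (power_graph G) = #|Q|.
Proof.
move=> p1 p2 rq1 rq2 q12 a0 b0 oQ r2.
apply: unique_minimum_cutset cutset_Hall proper_Hall _ => X.
case/cutset_dichotomy=> [|[M [A [B [maxM sM XE]]]]]; [by left | right].
have [c c0 oM] := card_maximal_cyclic maxM; have [_ cM] := maximal_cyclic_sub maxM.
apply: leq_trans (subset_leq_card (subsetIr M X)); rewrite -XE oQ.
have rc2 : 2 < r ^ c by rewrite (leq_trans r2) // -{1}(expn1 r) leq_exp2l ?prime_gt1.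
by apply: (ltn_missed cM sM r_pr p1 p2 _ _ _ _ _ c0 rc2) => //; rewrite oM oQ.
Qed.

(** * The case of a non-cyclic Sylow 2-subgroup *)

Section NoncyclicTwoSylow.

(* When #|Q| has just two prime factors q1 < q2, both odd, the inequality on the
   totient holds because (1 - 1/q1)(1 - 1/q2) >= (2/3)(4/5) > 1/2. *)
Hypotheses (r2 : r = 2) (halfQ : #|Q| < 2 * totient #|Q|).

Let oddQ : coprime 2 #|Q|.
Proof. by have := pHall_pgroup hallQ; rewrite r2 /pgroup p'natE // prime_coprime. Qed.

Lemma totient_2Hall c : totient (2 ^ c * #|Q|) = (totient (2 ^ c) * totient #|Q|)%N.
Proof. by rewrite totient_coprime ?coprimeXl. Qed.

Lemma ltn_missed_4Hall M A B c :
    cyclic M -> splits M A B -> #|M| = (2 ^ c * #|Q|)%N -> 1 < c ->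
  #|Q| < #|M :\: (A :|: B)|.
Proof.
move=> cM sM oM c1; apply: leq_trans (totient_le_missed cM sM).
rewrite oM totient_2Hall (leq_trans halfQ) // leq_mul2r totient_gt1.
by rewrite (@leq_trans (2 ^ 2)) ?leq_exp2l ?orbT.
Qed.

(** If both sides meet Q, the cut-set contains the generators of C and of Q,
    twice [totient #|Q|] elements. Otherwise some side lies in C outside Q. As
    Q has prime index in C, an element y of that side satisfies <y>Q = C, so a
    cyclic group <x> containing y gives <x>Q = C by maximality, and x is in C:
    the elements of G outside C can join the other side. *)
Lemma cutset_extends C Y :
    maximal_cyclic G C -> #|C| = (2 * #|Q|)%N -> cutset (power_graph C) Y ->
  cutset (power_graph G) Y \/ #|Q| < #|Y|.
Proof.
move=> maxC oC /cutset_power_graphP[sYC [A [B [A0 B0 AB UAB]]]].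
have [sCG cC] := maximal_cyclic_sub maxC.
have sQC := Hall_sub_maximal_cyclic maxC.
have pQC : Q \proper C.
  by rewrite properEcard sQC oC ltn_Pmull ?cardG_gt0.
have extend A' B' : A' :|: B' = C :\: Y -> B' != set0 -> A' != set0 ->
    incomparable A' B' -> Q :&: B' = set0 -> cutset (power_graph G) Y.
  move=> UAB' B'0 A'0 AB' QB'; apply/cutset_power_graphP.
  split; first exact: subset_trans sYC sCG.
  exists (A' :|: (G :\: C)), B'; split=> //.
  - by case/set0Pn: A'0 => a A'a; apply/set0Pn; exists a; rewrite inE A'a.
  - move=> x y /setUP[A'x|/setDP[Gx nCx]] B'y; first exact: AB'.
    have : y \in A' :|: B' by rewrite inE B'y orbT.
    rewrite UAB' => /setDP[Cy _].
    have nQy : y \notin Q.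
      by apply/negP=> Qy; have : y \in Q :&: B' by [apply/setIP]; rewrite QB' inE.
    apply/andP; split; apply: contra nCx.
      rewrite -cycle_subG => sxy.
      by rewrite -cycle_subG (subset_trans sxy) // cycle_subG.
    move=> yx; rewrite -(join_Hall_sub_maximal_cyclic maxC Gx).
      by rewrite mem_gen // inE cycle_id.
    have sQyC : <[y]> <*> Q \subset C by rewrite join_subG cycle_subG Cy.
    have -> : C = (<[y]> <*> Q)%G.
      apply/eqP; rewrite eq_sym -val_eqE eqEcard sQyC oC /=.
      have /dvdnP[k kE] := cardSg (joing_subr <[y]> Q).
      rewrite kE leq_mul2r orbC ltnNge; apply/orP; left; apply/negP=> k1.
      have le : #|<[y]> <*> Q| <= #|Q| by rewrite kE -{2}(mul1n #|Q|) leq_mul2r k1 orbT.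
      case/negP: nQy.
      have /eqP-> : Q == (<[y]> <*> Q)%G by rewrite -val_eqE eqEcard joing_subr le.
      by rewrite mem_gen // inE cycle_id.
    by rewrite genS // setSU // cycle_subG.
  - rewrite setUAC UAB'; apply/setP=> x; rewrite !inE.
    case Cx: (x \in C); rewrite ?andbF ?andbT /= ?orbF.
      by rewrite (subsetP sCG) ?andbT.
    by rewrite (contraFN (subsetP sYC x) Cx).
have := splitsN Q AB.
case=> [sQ|[QA|QB]].
- right; have sC : splits C A B.
    have sAC : A \subset C by apply: subset_trans (subsetDl C Y); rewrite -UAB subsetUl.
    have sBC : B \subset C by apply: subset_trans (subsetDl C Y); rewrite -UAB subsetUr.
    by split; rewrite ?(setIidPr sAC) ?(setIidPr sBC).
  have := totient2_le_missed cC pQC sC sQ.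
  rewrite UAB setDDr setDv set0U (setIidPr sYC) oC (totient_2Hall 1) mul1n addnn -mul2n.
  exact: leq_trans.
- by left; apply: (extend B A) => //; [rewrite setUC | apply: incomparable_sym].
- by left; apply: (extend A B).
Qed.

(** The sides are Q without the identity and {z}, where z is the involution of
    C. *)
Lemma kappa_cyclic_le_Hall C :
    Q :!=: 1 -> Q \subset C -> #|C| = (2 * #|Q|)%N ->
  kappa (power_graph C) <= #|Q|.
Proof.
move=> Q1 sQC oC.
have [|z Cz oz] := @Cauchy _ 2 C isT; first by rewrite oC dvdn_mulr.
have TIzQ : <[z]> :&: Q = 1 by rewrite coprime_TIg // -orderE oz.
have nQz x : z \in <[x]> -> x \notin Q.
  rewrite -!cycle_subG => szx; apply/negP=> sxQ.
  have /setIidPl zQ := subset_trans szx sxQ.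
  by have := congr1 (fun B : {set gT} => #|B|) TIzQ; rewrite zQ cards1 -orderE oz.
have nQzz := nQz z (cycle_id z).
pose A : {set gT} := Q^#; pose B := [set z].
have dAB : A :&: B = set0.
  apply/setP=> x; rewrite !inE; case: (x =P z) => [->|]; rewrite ?andbF //.
  by rewrite (negPf nQzz) ?andbF.
have sABC : A :|: B \subset C.
  by rewrite subUset sub1set Cz andbT (subset_trans (subsetDl _ _)).
have oAB : #|A :|: B| = #|Q|.
  by rewrite -[LHS]addn0 -(@cards0 gT) -dAB cardsUI cards1 (cardsD1 1 Q) group1 addnC.
have <- : #|C :\: (A :|: B)| = #|Q|.
  by have := cardsID (A :|: B) C; rewrite (setIidPr sABC) oAB oC mul2n -addnn => /addnI.
apply: kappa_le_cutset; apply/cutset_power_graphP; split; first exact: subsetDl.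
exists A, B; split.
- rewrite -subG1 in Q1; have [x Qx x1] := subsetPn Q1.
  by apply/set0Pn; exists x; rewrite !inE Qx -in_set1 x1.
- by apply/set0Pn; exists z; rewrite inE.
- move=> a b /setD1P[a1 Qa]; rewrite inE => /eqP->.
  have za : z \notin <[a]> by apply: contraL Qa; apply: nQz.
  rewrite za andbT; apply: contra a1 => az.
  by rewrite -in_set1 -[[set 1]]TIzQ inE az.
- by rewrite setDDr setDv set0U (setIidPr sABC).
Qed.

(** A cut-set of G not containing Q cuts a maximal cyclic subgroup M of order
    2^d * #|Q| with d >= c. If d > 1, this costs more than #|Q| elements; if
    d = 1, then c = 1 and M is isomorphic to C. *)
Lemma kappa_two_noncyclic C :
    min_order_maximal_cyclic G C -> Q :!=: 1 ->
  exists2 c, 0 < c & #|C| = (2 ^ c * #|Q|)%N /\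
    if c == 1%N
    then kappa (power_graph C) <= #|Q| /\ kappa (power_graph G) = kappa (power_graph C)
    else #|Q| <= kappa (power_graph C) /\ kappa (power_graph G) = #|Q|.
Proof.
case=> maxC minC Q1; have [c c0 oC] := card_maximal_cyclic maxC.
have [sCG cC] := maximal_cyclic_sub maxC; rewrite r2 in oC.
have sQC := Hall_sub_maximal_cyclic maxC.
have ltQG := proper_card proper_Hall.
have ltQC : #|Q| < #|C|.
  by rewrite oC ltn_Pmull ?cardG_gt0 // -[1%N](expn0 2) ltn_exp2l.
exists c => //; split=> //.
have missed_le M A B X : M :\: (A :|: B) = M :&: X -> #|M :\: (A :|: B)| <= #|X|.
  by move=> ->; rewrite subset_leq_card ?subsetIr.
have [c1 | c_neq1] := eqVneq c 1%N.
  rewrite c1 in oC; have kC := kappa_cyclic_le_Hall Q1 sQC oC.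
  split=> //; apply/eqP; rewrite eqn_leq; apply/andP; split.
    have kG := kappa_le_cutset cutset_Hall.
    apply: leq_kappa => [|Y /(cutset_extends maxC oC)[]]; first exact: leq_ltn_trans kG _.
      exact: kappa_le_cutset.
    by move/ltnW; apply: leq_trans.
  apply: leq_kappa => [|X]; first exact: leq_ltn_trans kC _.
  case/cutset_dichotomy=> [/subset_leq_card|[M [A [B [maxM sM XE]]]]].
    exact: leq_trans.
  apply: leq_trans (missed_le _ _ _ _ XE).
  have [d d0 oM] := card_maximal_cyclic maxM; have [_ cM] := maximal_cyclic_sub maxM.
  rewrite r2 in oM; have [d1|d_neq1] := eqVneq d 1%N.
    by apply: kappa_cyclic_le_missed => //; rewrite oM oC d1.
  apply: leq_trans kC (ltnW (ltn_missed_4Hall cM sM oM _)).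
  by rewrite ltn_neqAle eq_sym d_neq1.
have c_gt1 : 1 < c by rewrite ltn_neqAle eq_sym c_neq1.
split.
  apply: leq_kappa => // Y /cutset_power_graphP[sYC [A [B [A0 B0 AB UAB]]]].
  have [sAC sBC] : A \subset C /\ B \subset C.
    by apply/andP; rewrite -subUset UAB subsetDl.
  have sC : splits C A B by split; rewrite ?(setIidPr sAC) ?(setIidPr sBC).
  have := ltn_missed_4Hall cC sC oC c_gt1.
  by rewrite UAB setDDr setDv set0U (setIidPr sYC) => /ltnW.
apply/eqP; rewrite eqn_leq (kappa_le_cutset cutset_Hall).
apply: leq_kappa => // X.
case/cutset_dichotomy=> [/subset_leq_card //|[M [A [B [maxM sM XE]]]]].
apply: leq_trans (missed_le _ _ _ _ XE).
have [d d0 oM] := card_maximal_cyclic maxM; have [_ cM] := maximal_cyclic_sub maxM.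
rewrite r2 in oM; apply: ltnW (ltn_missed_4Hall cM sM oM _).
apply: leq_trans c_gt1 _; have := minC M maxM.
by rewrite oM oC leq_pmul2r ?cardG_gt0 // leq_exp2l.
Qed.

End NoncyclicTwoSylow.

End OneNoncyclicSylow.

(** * The Sylow subgroups for three distinct primes *)

Section ThreePrimes.

Variables (gT : finGroupType) (G : {group gT}).
Variables (p n : 'I_3 -> nat) (P : 'I_3 -> {group gT}).
Hypotheses (p_prime : forall i, prime (p i)) (p_inj : injective p).
Hypothesis abelG : abelian G.
Hypothesis oG : #|G| = \prod_i p i ^ n i.
Hypothesis sylP : forall i, ((p i).-Sylow(G) (P i))%g.

Lemma card_Sylow_factor i : #|P i| = p i ^ n i.
Proof.
rewrite (card_Hall (sylP i)) p_part oG; congr (_ ^ _).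
have pn_gt0 j : 0 < p j ^ n j by rewrite expn_gt0 prime_gt0.
rewrite (bigD1 i) //= lognM ?prodn_cond_gt0 //.
rewrite lognX logn_prime // eqxx muln1 logn_coprime ?addn0 //.
apply: (big_ind (coprime (p i))) => [|x y cx cy|j ji].
- exact: coprimen1.
- by rewrite coprimeMr cx.
- by rewrite (@coprime_pexp _ _ 1) // (inj_eq p_inj) eq_sym.
Qed.

Variables (i j k : 'I_3).
Hypothesis ijk : [set i; j; k] = [set: 'I_3].

Lemma three_distinct : [/\ i != j, k != i & k != j].
Proof.
have /eqP := congr1 (fun A : {set 'I_3} => #|A|) ijk.
rewrite cardsT card_ord (setUC _ [set k]) cardsU1 cards2 !inE negb_or.
by case: (i == j); case: (k == i); case: (k == j).
Qed.

Let Q := (P i <*> P j)%G.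

Lemma mulg_Sylow_join : (P i * P j)%g = Q.
Proof.
rewrite /Q /= comm_joingE //; apply/normC/cents_norm.
by rewrite (sub_abelian_cent2 abelG) ?(pHall_sub (sylP _)).
Qed.

Lemma card_Sylow_join : #|Q| = p i ^ n i * p j ^ n j.
Proof.
have [ij _ _] := three_distinct.
rewrite -mulg_Sylow_join coprime_cardMg !card_Sylow_factor //.
by rewrite coprime_pexp // (inj_eq p_inj).
Qed.

Lemma Hall_Sylow_join : ((p k)^'.-Hall(G) Q)%g.
Proof.
have [ij ki kj] := three_distinct.
have sQG : Q \subset G by rewrite join_subG !(pHall_sub (sylP _)).
have oGQ : #|G| = p k ^ n k * #|Q|.
  rewrite oG card_Sylow_join (bigD1 k) //= (bigD1 i) 1?eq_sym //= (bigD1 j) /=; last first.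
    by rewrite ![j == _]eq_sym kj ij.
  rewrite big1 ?muln1 // => l /andP[/andP[lk li] lj].
  by have := in_setT l; rewrite -ijk !inE (negPf lk) (negPf li) (negPf lj).
rewrite /pHall sQG /pgroup -divgS // oGQ mulnK // pnatNK pnatX pnat_id //= andbT.
rewrite p'natE // -prime_coprime // card_Sylow_join coprimeMr.
by rewrite !(@coprime_pexp _ _ 1) // (inj_eq p_inj).
Qed.

Lemma cyclic_Sylow_join : cyclic (P i) -> cyclic (P j) -> cyclic Q.
Proof.
have [ij _ _] := three_distinct => cPi cPj.
rewrite /Q /= cyclicY // ?(sub_abelian_cent2 abelG) ?(pHall_sub (sylP _)) //.
by rewrite !card_Sylow_factor coprime_pexp // (inj_eq p_inj).
Qed.

End ThreePrimes.

Theorem theorem1p4 (gT : finGroupType) (G : {group gT})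
    (p n : 'I_3 -> nat) (P : 'I_3 -> {group gT})
    (p_prime : forall i, prime (p i))
    (p_lt12 : p i1 < p i2) (p_lt23 : p i2 < p i3)
    (n_gt0 : forall i, 0 < n i)
    (abelG : abelian G) (ncycG : ~~ cyclic G)
    (oG : #|G| = p i1 ^ n i1 * p i2 ^ n i2 * p i3 ^ n i3)
    (sylP : forall i, ((p i).-Sylow(G) (P i))%g)
    (one_ncyc : #|[set i | ~~ cyclic (P i)]| = 1) :
  (* (i) *)
  (p i1 = 2 -> ~~ cyclic (P i1) ->
     forall C : {group gT}, min_order_maximal_cyclic G C ->
       kappa (power_graph G)
         = minn #|(P i2 * P i3)%g| (kappa (power_graph C))
       /\ (forall c : nat, 0 < c ->
             #|C| = 2 ^ c * p i2 ^ n i2 * p i3 ^ n i3 ->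
             (1 < c -> kappa (power_graph G) = #|(P i2 * P i3)%g|)
             /\ (c = 1 -> kappa (power_graph G) = kappa (power_graph C))))
  (* (ii) *)
  /\ (p i1 = 2 -> forall j k : 'I_3, [set j; k] = [set i2; i3] ->
        ~~ cyclic (P k) ->
        (forall X : {set gT},
           minimum_cutset (power_graph G) X <-> X = (P i1 * P j)%g)
        /\ kappa (power_graph G) = #|(P i1 * P j)%g|
        /\ #|(P i1 * P j)%g| = p i1 ^ n i1 * p j ^ n j)
  (* (iii) *)
  /\ (3 <= p i1 -> forall i j k : 'I_3, [set i; j; k] = [set: 'I_3] ->
        ~~ cyclic (P k) ->
        (forall X : {set gT},
           minimum_cutset (power_graph G) X <-> X = (P i * P j)%g)
        /\ kappa (power_graph G) = #|(P i * P j)%g|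
        /\ #|(P i * P j)%g| = p i ^ n i * p j ^ n j).
Proof.
have I3P (l : 'I_3) : [\/ l = i1, l = i2 | l = i3].
  case: l => [[|[|[|l]]] ltl] //; [constructor 1 | constructor 2 | constructor 3];
    exact: val_inj.
have p_inj : injective p.
  by move=> l l'; case: (I3P l) => ->; case: (I3P l') => -> // eqp; exfalso; lia.
have oG' : #|G| = \prod_i p i ^ n i.
  rewrite oG !big_ord_recr big_ord0 /= mul1n.
  by congr (_ * _ * _); congr (p _ ^ n _); apply: val_inj.
have min_p l : p i1 <= p l by case: (I3P l) => ->; lia.
have cycP k l : ~~ cyclic (P k) -> l != k -> cyclic (P l).
  move=> ncPk lk; apply: contraTT isT => ncPl.
  have : [set l; k] \subset [set i | ~~ cyclic (P i)].
    by rewrite subUset !sub1set !inE ncPl.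
  by move/subset_leq_card; rewrite one_ncyc cards2 lk.
have oddcase i j k : 2 < p k -> [set i; j; k] = [set: 'I_3] -> ~~ cyclic (P k) ->
    (forall X : {set gT}, minimum_cutset (power_graph G) X <-> X = (P i * P j)%g)
    /\ kappa (power_graph G) = #|(P i * P j)%g|
    /\ #|(P i * P j)%g| = p i ^ n i * p j ^ n j.
  move=> pk2 ijk ncPk; have [ij ki kj] := three_distinct ijk.
  rewrite (mulg_Sylow_join abelG sylP i j).
  have cQ : cyclic (P i <*> P j)%g.
    apply: (cyclic_Sylow_join p_prime p_inj abelG oG' sylP ijk).
      by rewrite (cycP k) // eq_sym.
    by rewrite (cycP k) // eq_sym.
  have hQ := Hall_Sylow_join p_prime p_inj abelG oG' sylP ijk.
  have oQ := card_Sylow_join p_prime p_inj abelG oG' sylP ijk.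
  have pneq l l' : l != l' -> p l != p l' by rewrite (inj_eq p_inj).
  have [uniqQ kQ] :=
    unique_minimum_cutset_Hall abelG (p_prime k) (sylP k) ncPk hQ cQ
    (p_prime i) (p_prime j) (pneq _ _ ki) (pneq _ _ kj) (pneq _ _ ij)
    (n_gt0 i) (n_gt0 j) oQ pk2.
  by [].
split; last split; last first.
- by move=> p3 i j k ijk; apply: oddcase => //; apply: leq_trans p3 (min_p k).
- move=> p2 j k jk; apply: oddcase.
    have : k \in [set i2; i3] by rewrite -jk !inE eqxx orbT.
    by rewrite !inE => /orP[] /eqP->; lia.
  rewrite -setUA jk; apply/setP=> l; rewrite !inE.
  by case: (I3P l) => ->.
move=> p2 ncP1 C minC.
have ijk : [set i2; i3; i1] = [set: 'I_3].
  by apply/setP=> l; rewrite !inE; case: (I3P l) => ->.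
have [ij ki kj] := three_distinct ijk.
rewrite (mulg_Sylow_join abelG sylP i2 i3).
have cQ : cyclic (P i2 <*> P i3)%g.
  by apply: (cyclic_Sylow_join p_prime p_inj abelG oG' sylP ijk); rewrite (cycP i1).
have hQ := Hall_Sylow_join p_prime p_inj abelG oG' sylP ijk.
have oQ := card_Sylow_join p_prime p_inj abelG oG' sylP ijk.
set Q := (P i2 <*> P i3)%G in hQ oQ *.
have Q_gt1 : 1 < #|Q|.
  rewrite oQ (@leq_trans (p i2 ^ n i2)) ?leq_pmulr ?expn_gt0 ?prime_gt0 //.
  by rewrite -(expn0 (p i2)) ltn_exp2l ?prime_gt1.
(* totient 4 = 2, so the bound for r^c = 4 is the wanted inequality. *)
have halfQ : #|Q| < 2 * totient #|Q|.
  have := @ltn_totient_mul 2 2 (p i2) (n i2) (p i3) (n i3).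
  rewrite -oQ totient_coprime; last first.
    have := pHall_pgroup hQ; rewrite p2 /pgroup p'natE // -prime_coprime //.
    exact: coprimeXl.
  apply; rewrite //= ?p_prime //; lia.
have [|c c0 [oC kC]] :=
    kappa_two_noncyclic abelG (p_prime i1) (sylP i1) ncP1 hQ cQ p2 halfQ minC.
  by rewrite -cardG_gt1.
have {}oC : #|C| = 2 ^ c * p i2 ^ n i2 * p i3 ^ n i3 by rewrite oC oQ mulnA.
split.
  case: ifP kC => _ [le ->]; first by rewrite (minn_idPr le).
  by rewrite (minn_idPl le).
move=> d d0; rewrite oC => /eqP.
rewrite !eqn_pmul2r ?expn_gt0 ?prime_gt0 // eqn_exp2l // => /eqP <-.
split=> c1; move: kC; first by rewrite gtn_eqF // => -[].
by rewrite c1 eqxx => -[].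
Qed.
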